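(* Let $k,m>0$ and let $q_0\ne0$ satisfy $1+4k=4q_0$. Consider the Sturm-Liouville problem in Liouville normal form $$\text{(N)}\qquad -\frac{d^2v}{dt^2}+\frac{k}{(t+m)^2}v=\lambda v,\quad 0<t<\pi,\qquad v(0)=0=v(\pi),$$ with constant potential function $q=q_0$ and density function $r=\tau^2$, where $\tau=t+m$. Then for every $x_0\in\mathbb R$, (N) admits the following canonical form with Dirichlet boundary conditions: $$-\frac{d^2u}{dx^2}+q_0\,u=\lambda\,e^{2(x+x_0)}\,u,\qquad a<x<b,\qquad u(a)=0=u(b),$$ where $$a=-x_0+\ln m,\qquad b=-x_0+\ln(\pi+m),\qquad \delta_0=m,\qquad \gamma_0=\pi+m.$$
   Context: A canonical form is a problem $-(p\,u')'+q\,u=\lambda r\,u$ on $a<x<b$ with boundary conditions $\delta_0u(a)-\delta_1p(a)u'(a)=0$, $\gamma_0u(b)-\gamma_1p(b)u'(b)=0$; here $\delta_1=\gamma_1=0$. We say that (N) admits this canonical form if the two are related by Liouville's transformation: there is an increasing bijection $t\mapsto x(t)$ from $[0,\pi]$ onto $[a,b]$ with $dx/dt=\sqrt{p/r}$, and with $w=(pr)^{-1/4}$ one has $$\frac{k}{(t+m)^2}=\frac qr+w\frac{d^2}{dt^2}\left(\frac1w\right),$$ so that $u=wv$ turns (N), for every $\lambda$, into the canonical problem. The boundary coefficients are normalized by $\delta_0=1/w^2$ at $x=a$ and $\gamma_0=1/w^2$ at $x=b$. *)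

(* Defs.v *)
From Stdlib Require Import Reals.
From Coquelicot Require Import Coquelicot.
Open Scope R_scope.

(** The problem [-(p u')' + q u = lam r u] on [a < x < b] with
    [delta0 u(a) - delta1 p(a) u'(a) = 0], [gamma0 u(b) - gamma1 p(b) u'(b) = 0]. *)
Record SLproblem := MkSL {
  sl_a : R;
  sl_b : R;
  sl_p : R -> R;
  sl_q : R -> R;
  sl_r : R -> R;
  sl_delta0 : R;
  sl_delta1 : R;
  sl_gamma0 : R;
  sl_gamma1 : R
}.

(** Classical solutions, C^1 up to the endpoints.  [u1] is the derivative of
    [u]; being continuous on the closed interval, its values at [a] and [b] are
    the one-sided derivatives of [u].  Values of [u] outside [[a, b]] play no
    role.  The zero function is not excluded. *)
Definition sl_solution (P : SLproblem) (lam : R) (u : R -> R) : Prop :=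
  exists u1 : R -> R,
    continuous_on (fun x => sl_a P <= x <= sl_b P) u /\
    continuous_on (fun x => sl_a P <= x <= sl_b P) u1 /\
    (forall x, sl_a P < x < sl_b P ->
       is_derive u x (u1 x) /\
       ex_derive (fun s => sl_p P s * u1 s) x /\
       - Derive (fun s => sl_p P s * u1 s) x + sl_q P x * u x
         = lam * sl_r P x * u x) /\
    sl_delta0 P * u (sl_a P) - sl_delta1 P * (sl_p P (sl_a P) * u1 (sl_a P)) = 0 /\
    sl_gamma0 P * u (sl_b P) - sl_gamma1 P * (sl_p P (sl_b P) * u1 (sl_b P)) = 0.

Definition normal_form (Q : R -> R) : SLproblem :=
  {| sl_a := 0; sl_b := PI;
     sl_p := fun _ => 1; sl_q := Q; sl_r := fun _ => 1;
     sl_delta0 := 1; sl_delta1 := 0; sl_gamma0 := 1; sl_gamma1 := 0 |}.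

Definition canonical_form (q0 x0 a b delta0 gamma0 : R) : SLproblem :=
  {| sl_a := a; sl_b := b;
     sl_p := fun _ => 1; sl_q := fun _ => q0; sl_r := fun x => exp (2 * (x + x0));
     sl_delta0 := delta0; sl_delta1 := 0; sl_gamma0 := gamma0; sl_gamma1 := 0 |}.

Definition increasing_bijection (c d a b : R) (x : R -> R) : Prop :=
  (forall s t, c <= s -> s < t -> t <= d -> x s < x t) /\
  (forall t, c <= t <= d -> a <= x t <= b) /\
  (forall y, a <= y <= b -> exists t, c <= t <= d /\ x t = y).

(** The weight [w = (p r)^(-1/4)] as a function of [x]. *)
Definition liouville_weight (C : SLproblem) (x : R) : R :=
  Rpower (sl_p C x * sl_r C x) (- (1 / 4)).

(** [x] realizes Liouville's transformation between the Dirichlet problem in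
    normal form with potential [Q] and the problem [C].  Positivity of [p] and
    [r] is what makes the square root and the real power meaningful.  Since [x]
    only matters on [[0, PI]], derivatives in [t] are taken in the interior. *)
Definition liouville_transformation (Q : R -> R) (C : SLproblem) (x : R -> R)
    : Prop :=
  let w t := liouville_weight C (x t) in
  (forall y, sl_a C <= y <= sl_b C -> 0 < sl_p C y /\ 0 < sl_r C y) /\
  increasing_bijection 0 PI (sl_a C) (sl_b C) x /\
  (forall t, 0 < t < PI -> is_derive x t (sqrt (sl_p C (x t) / sl_r C (x t)))) /\
  (forall t, 0 < t < PI ->
     ex_derive_n (fun s => 1 / w s) 1 t /\
     ex_derive_n (fun s => 1 / w s) 2 t /\
     Q t = sl_q C (x t) / sl_r C (x t)
           + w t * Derive_n (fun s => 1 / w s) 2 t) /\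
  sl_delta0 C = 1 / (liouville_weight C (sl_a C)) ^ 2 /\
  sl_gamma0 C = 1 / (liouville_weight C (sl_b C)) ^ 2 /\
  (forall (lam : R) (v u : R -> R),
     (forall t, 0 <= t <= PI -> u (x t) = w t * v t) ->
     (sl_solution (normal_form Q) lam v <-> sl_solution C lam u)).

(* Main.v *)
(** With [x t = ln (t + m) - x0] one has [dx/dt = 1 / (t + m)], and the weight
    is [w = (t + m)^(-1/2)], so that [w (1/w)'' = - 1 / (4 (t + m)^2)] and the
    potential of the normal form is [(q0 - 1/4) / (t + m)^2 = k / (t + m)^2].
    In both directions the transformation of solutions has the shape
    [g = om * (f o phi)] with [phi' = 1 / om^2]: this choice cancels the
    first-order term, and [f'' = c f] becomes
    [g'' = (om'' / om + (c o phi) / om^4) g]. *)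
Require Import Defs.
From Stdlib Require Import Reals Lra.
From Coquelicot Require Import Coquelicot.
Open Scope R_scope.

(** * Continuity relative to a subset *)

Lemma continuous_on_mult (D : R -> Prop) (f g : R -> R) :
  continuous_on D f -> continuous_on D g -> continuous_on D (fun x => f x * g x).
Proof.
  intros hf hg x hx.
  exact (filterlim_comp_2 _ _ _ (hf x hx) (hg x hx)
           (filterlim_mult (K := R_AbsRing) (f x) (g x))).
Qed.

Lemma continuous_on_plus (D : R -> Prop) (f g : R -> R) :
  continuous_on D f -> continuous_on D g -> continuous_on D (fun x => f x + g x).
Proof.
  intros hf hg x hx.
  exact (filterlim_comp_2 _ _ _ (hf x hx) (hg x hx)
           (filterlim_plus (V := R_NormedModule) (f x) (g x))).
Qed.

(** Since [phi] carries [D] into [E], the trace on [D] of a small neighbourhood lands in [E], where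
    [f] is controlled; continuity at an endpoint stays one-sided. *)
Lemma continuous_on_comp (D E : R -> Prop) (f phi : R -> R) :
  continuous_on E f -> continuous_on D phi -> (forall y, D y -> E (phi y)) ->
  continuous_on D (fun y => f (phi y)).
Proof.
  intros hf hphi hDE y hy.
  apply filterlim_comp with (2 := hf (phi y) (hDE y hy)).
  intros P hP.
  generalize (hphi y hy _ hP).
  unfold filtermap, within; apply filter_imp; auto.
Qed.

Lemma is_derive_continuous_on (D : R -> Prop) (f df : R -> R) :
  (forall y, D y -> is_derive f y (df y)) -> continuous_on D f.
Proof.
  intros hf; apply continuous_on_forall; intros y hy.
  apply (ex_derive_continuous (V := R_NormedModule) f y); exists (df y); auto.
Qed.

Lemma locally_open_interval (a b x : R) :
  a < x < b -> locally x (fun y => a < y < b).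
Proof.
  intros [h1 h2].
  now apply (locally_interval _ x a b).
Qed.

(** * Transfer of solutions between Dirichlet problems *)

(** [normal_form] and [canonical_form] are both convertible to instances of this, so one transfer
    lemma serves both directions. *)
Definition dirichlet_problem (a b : R) (q r : R -> R) (d g : R) : SLproblem :=
  MkSL a b (fun _ => 1) q r d 0 g 0.

Lemma sl_solution_dirichlet (a b : R) (q r : R -> R) (d g lam : R) (u : R -> R) :
  d <> 0 -> g <> 0 ->
  sl_solution (dirichlet_problem a b q r d g) lam u <->
  exists u1 : R -> R,
    continuous_on (fun x => a <= x <= b) u /\
    continuous_on (fun x => a <= x <= b) u1 /\
    (forall x, a < x < b ->
       is_derive u x (u1 x) /\ is_derive u1 x ((q x - lam * r x) * u x)) /\
    u a = 0 /\ u b = 0.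
Proof.
  intros hd hg; unfold sl_solution, dirichlet_problem; simpl.
  assert (hE : forall (c z y : R), c <> 0 -> c * z - 0 * y = 0 <-> z = 0).
  { intros c z y hc; split; intros h.
    - apply Rmult_eq_reg_l with c; lra.
    - rewrite h; ring. }
  split; intros [u1 (hu & hu1 & hode & ha & hb)]; exists u1.
  - apply (hE d) in ha; apply (hE g) in hb; trivial.
    do 2 (split; trivial); split; [ | now split].
    intros x hx; destruct (hode x hx) as (hder & hex & heq); split; trivial.
    replace ((q x - lam * r x) * u x) with (Derive (fun s => 1 * u1 s) x) by lra.
    apply is_derive_ext with (fun s => 1 * u1 s).
    + intros s; apply Rmult_1_l.
    + now apply Derive_correct.
  - do 2 (split; trivial); split; [ | split; now apply hE].
    intros x hx; destruct (hode x hx) as [h1 h2].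
    assert (h3 : is_derive (fun s => 1 * u1 s) x ((q x - lam * r x) * u x)).
    { apply is_derive_ext with u1; trivial.
      intros s; symmetry; apply Rmult_1_l. }
    split; [trivial | split; [now exists ((q x - lam * r x) * u x) | ]].
    apply is_derive_unique in h3.
    change (Derive (fun s : R => 1 * u1 s) x = (q x - lam * r x) * u x) in h3.
    rewrite h3; ring.
Qed.

(** The new equation has coefficient [om2 / om + (q - lam r) / om ^ 4], with [q] and [r] taken at
    [phi y]; the hypotheses on [q'] and [r'] match its part free of [lam] and its part linear in
    [lam]. *)
Lemma sl_solution_liouville (a b a' b' : R) (q r q' r' : R -> R)
    (d g d' g' lam : R) (om om1 om2 phi u v : R -> R) :
  d <> 0 -> g <> 0 -> d' <> 0 -> g' <> 0 -> a' <= b' ->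
  (forall y, a' <= y <= b' -> om y <> 0) ->
  (forall y, a' <= y <= b' -> is_derive om y (om1 y)) ->
  (forall y, a' <= y <= b' -> is_derive om1 y (om2 y)) ->
  (forall y, a' <= y <= b' -> is_derive phi y (/ om y ^ 2)) ->
  phi a' = a -> phi b' = b ->
  (forall y, a' < y < b' -> a < phi y < b) ->
  (forall y, a' < y < b' -> q' y = om2 y / om y + q (phi y) / om y ^ 4) ->
  (forall y, a' < y < b' -> r' y = r (phi y) / om y ^ 4) ->
  (forall y, a' <= y <= b' -> v y = om y * u (phi y)) ->
  sl_solution (dirichlet_problem a b q r d g) lam u ->
  sl_solution (dirichlet_problem a' b' q' r' d' g') lam v.
Proof.
  intros hd hg hd' hg' hab hom hom1 hom2 hphi hphia hphib hin hq hr hv hu.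
  apply sl_solution_dirichlet in hu; trivial.
  apply sl_solution_dirichlet; trivial.
  destruct hu as [u1 (cu & cu1 & hode & hua & hub)].
  (* [hin] speaks of interior points only. At an endpoint, the image of the midpoint supplies
     [a < b]; if [a' = b'], then [a = b]. *)
  assert (hmap : forall y, a' <= y <= b' -> a <= phi y <= b).
  { intros y [[h1 | h1] [h2 | h2]].
    - destruct (hin y); lra.
    - subst y; rewrite hphib; split; [ | lra].
      destruct (hin ((a' + b') / 2)); lra.
    - subst y; rewrite hphia; split; [lra | ].
      destruct (hin ((a' + b') / 2)); lra.
    - assert (a = b) by (rewrite <- hphia, <- hphib; f_equal; lra).
      subst y; rewrite hphia; lra. }
  assert (cphi := is_derive_continuous_on (fun y => a' <= y <= b') _ _ hphi).
  assert (com := is_derive_continuous_on (fun y => a' <= y <= b') _ _ hom1).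
  assert (com1 := is_derive_continuous_on (fun y => a' <= y <= b') _ _ hom2).
  (* Product rule, with [om * phi' = / om]. *)
  exists (fun y => om1 y * u (phi y) + / om y * u1 (phi y)).
  split; [ | split; [ | split; [ | split]]].
  - apply continuous_on_ext with (fun y => om y * u (phi y)).
    + intros y hy; symmetry; now apply hv.
    + apply continuous_on_mult; trivial.
      now apply continuous_on_comp with (2 := cphi) (1 := cu).
  - apply continuous_on_plus; apply continuous_on_mult; trivial.
    + now apply continuous_on_comp with (2 := cphi) (1 := cu).
    + apply is_derive_continuous_on with (fun y => - om1 y / om y ^ 2).
      intros y hy; apply is_derive_inv; auto.
    + now apply continuous_on_comp with (2 := cphi) (1 := cu1).
  - intros y hy.
    assert (hyc : a' <= y <= b') by lra.
    specialize (hom y hyc); specialize (hom1 y hyc).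
    specialize (hom2 y hyc); specialize (hphi y hyc).
    destruct (hode (phi y) (hin y hy)) as [h1 h2].
    assert (hc1 := is_derive_comp _ _ _ _ _ h1 hphi).
    assert (hc2 := is_derive_comp _ _ _ _ _ h2 hphi).
    split.
    + apply is_derive_ext_loc with (fun z => om z * u (phi z)).
      * apply filter_imp with (2 := locally_open_interval _ _ _ hy).
        intros z hz; symmetry; apply hv; lra.
      * evar_last.
        { apply (is_derive_mult _ _ _ _ _ hom1 hc1 Rmult_comm). }
        unfold plus, mult, scal; simpl; unfold mult; simpl; field; trivial.
    + rewrite (hv y hyc), (hq y hy), (hr y hy).
      evar_last.
      { apply @is_derive_plus.
        - apply (is_derive_mult _ _ _ _ _ hom2 hc1 Rmult_comm).
        - apply (is_derive_mult (fun z => / om z) _ _ _ _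
                   (is_derive_inv _ _ _ hom1 hom) hc2 Rmult_comm). }
      (* The two terms [om1 / om ^ 2] times [u1 (phi y)] have opposite signs and cancel. *)
      unfold plus, mult, scal; simpl; unfold mult; simpl; field; trivial.
  - rewrite hv by lra; rewrite hphia, hua; ring.
  - rewrite hv by lra; rewrite hphib, hub; ring.
Qed.

(** * Derivatives of the square root and the closed form of the weight *)

Lemma is_derive_sqrt_shift (m t : R) :
  0 < t + m -> is_derive (fun s => sqrt (s + m)) t (/ (2 * sqrt (t + m))).
Proof.
  intros h; assert (hs := sqrt_lt_R0 _ h).
  auto_derive; [trivial | field; lra].
Qed.

Lemma is_derive_inv_sqrt_shift (m t : R) :
  0 < t + m ->
  is_derive (fun s => / (2 * sqrt (s + m))) t (- / (4 * sqrt (t + m) ^ 3)).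
Proof.
  intros h; assert (hs := sqrt_lt_R0 _ h).
  auto_derive.
  - repeat split; trivial; lra.
  - field; lra.
Qed.

Lemma sqrt_pow4 (y : R) : 0 <= y -> sqrt y ^ 4 = y ^ 2.
Proof.
  intros h; replace (sqrt y ^ 4) with ((sqrt y ^ 2) ^ 2) by ring.
  now rewrite pow2_sqrt.
Qed.

Lemma exp_half_ln (y : R) : 0 < y -> exp (ln y / 2) = sqrt y.
Proof.
  intros h; symmetry; apply sqrt_lem_1; [lra | apply Rlt_le, exp_pos | ].
  rewrite <- exp_plus.
  replace (ln y / 2 + ln y / 2) with (ln y) by field.
  now apply exp_ln.
Qed.

(** The logarithm in [Rpower] undoes the exponential in [r]. This form serves as the multiplier from
    [v] to [u]. *)
Lemma liouville_weight_canonical_form (q0 x0 a b d g y : R) :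
  liouville_weight (canonical_form q0 x0 a b d g) y = exp (- ((y + x0) / 2)).
Proof.
  unfold liouville_weight, Rpower; simpl.
  rewrite Rmult_1_l, ln_exp; f_equal; field.
Qed.

(** * The explicit Liouville transformation *)

Theorem theorem3 (k m q0 : R) (hk : 0 < k) (hm : 0 < m) (hq0 : q0 <> 0)
    (hkq : 1 + 4 * k = 4 * q0) (x0 : R) :
  let C := canonical_form q0 x0
             (- x0 + ln m) (- x0 + ln (PI + m)) m (PI + m) in
  exists x : R -> R,
    liouville_transformation (fun t => k / (t + m) ^ 2) C x /\
    (forall t, 0 <= t <= PI -> sl_q C (x t) = q0 /\ sl_r C (x t) = (t + m) ^ 2) /\
    (forall (lam : R) (u : R -> R), sl_solution C lam u ->
       u (sl_a C) = 0 /\ u (sl_b C) = 0).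
Proof.
  intros C; assert (hpi := PI_RGT_0).
  (* Separating variables in [dx/dt = exp (- (x + x0))] gives [exp (x + x0) = t + c], and [x 0 = a]
     forces [c = m]. *)
  set (x := fun t => - x0 + ln (t + m)).
  assert (hrt : forall t, 0 < t + m -> exp (2 * (x t + x0)) = (t + m) ^ 2).
  { intros t ht; unfold x.
    replace (2 * (- x0 + ln (t + m) + x0)) with (ln (t + m) + ln (t + m)) by ring.
    rewrite exp_plus, exp_ln by trivial; ring. }
  assert (hw : forall t, 0 < t + m -> liouville_weight C (x t) = / sqrt (t + m)).
  { intros t ht; unfold C; rewrite liouville_weight_canonical_form, exp_Ropp.
    unfold x; replace ((- x0 + ln (t + m) + x0) / 2) with (ln (t + m) / 2) by field.
    now rewrite exp_half_ln. }
  assert (hwinv : forall t, 0 < t + m ->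
    1 / liouville_weight C (x t) = sqrt (t + m)).
  { intros t ht; rewrite (hw t ht); assert (h := sqrt_lt_R0 _ ht); field; lra. }
  assert (hxlt : forall s t, 0 < s + m -> s < t -> x s < x t).
  { intros s t hs hst; unfold x; apply Rplus_lt_compat_l, ln_increasing; lra. }
  assert (hxa : x 0 = - x0 + ln m) by (unfold x; now rewrite Rplus_0_l).
  assert (hdx : forall t, 0 < t + m -> is_derive x t (/ (t + m))).
  { intros t ht; unfold x; auto_derive; [trivial | field; lra]. }
  (* The inverse of [x]. *)
  set (ti := fun y => exp (y + x0) - m).
  assert (htix : forall y, x (ti y) = y).
  { intros y; unfold x, ti.
    replace (exp (y + x0) - m + m) with (exp (y + x0)) by ring.
    rewrite ln_exp; ring. }
  assert (htipos : forall y, 0 < ti y + m).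
  { intros y; unfold ti; assert (h := exp_pos (y + x0)); lra. }
  assert (hxti : forall t, 0 < t + m -> ti (x t) = t).
  { intros t ht; unfold x, ti.
    replace (- x0 + ln (t + m) + x0) with (ln (t + m)) by ring.
    rewrite exp_ln by trivial; ring. }
  assert (htilt : forall y z, y < z -> ti y < ti z).
  { intros y z h; unfold ti; apply Rplus_lt_compat_r, exp_increasing; lra. }
  assert (hti0 : ti (- x0 + ln m) = 0) by (rewrite <- hxa; apply hxti; lra).
  assert (htipi : ti (- x0 + ln (PI + m)) = PI) by (apply hxti; lra).
  assert (htile : forall y z, y <= z -> ti y <= ti z).
  { intros y z [h | ->]; [apply Rlt_le; auto | lra]. }
  assert (htic : forall y, - x0 + ln m <= y <= - x0 + ln (PI + m) -> 0 <= ti y <= PI).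
  { intros y [h1 h2]; apply htile in h1; apply htile in h2; lra. }
  assert (hd2 : forall t, 0 < t + m ->
    is_derive_n (fun s => 1 / liouville_weight C (x s)) 2 t
      (- / (4 * sqrt (t + m) ^ 3))).
  { intros t ht.
    (* [1 / w] equals [sqrt (s + m)] only for [s + m > 0]; elsewhere the default values of [ln] and
       [sqrt] disagree, so both derivatives are compared locally. *)
    assert (hloc : locally t (fun s => 0 < s + m)).
    { apply filter_imp with (fun s => - m < s < t + 1).
      - intros s hs; lra.
      - apply locally_open_interval; lra. }
    apply is_derive_n_ext_loc with (fun s => sqrt (s + m)).
    - apply filter_imp with (2 := hloc).
      intros s hs; symmetry; now apply hwinv.
    - simpl; apply is_derive_ext_loc with (fun s => / (2 * sqrt (s + m))).
      + apply filter_imp with (2 := hloc).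
        intros s hs; symmetry; apply is_derive_unique.
        now apply is_derive_sqrt_shift.
      + now apply is_derive_inv_sqrt_shift. }
  exists x; split; [ | split].
  - unfold liouville_transformation; cbv beta zeta.
    split; [ | split; [ | split; [ | split; [ | split; [ | split]]]]].
    + intros y _; simpl; split; [lra | apply exp_pos].
    + split; [ | split].
      * intros s t hs hst _; apply hxlt; lra.
      * simpl; intros t [h0 h1]; rewrite <- hxa; fold (x PI); split.
        -- destruct h0 as [h0 | <-]; [apply Rlt_le, hxlt; lra | lra].
        -- destruct h1 as [h1 | ->]; [apply Rlt_le, hxlt; lra | lra].
      * simpl; intros y hy; exists (ti y); auto.
    + intros t ht; simpl; rewrite hrt by lra.
      replace (1 / (t + m) ^ 2) with ((/ (t + m)) ^ 2) by (field; lra).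
      rewrite sqrt_pow2 by (apply Rlt_le, Rinv_0_lt_compat; lra).
      apply hdx; lra.
    + intros t ht; assert (htm : 0 < t + m) by lra.
      split; [ | split].
      * change (ex_derive (fun s => 1 / liouville_weight C (x s)) t).
        apply ex_derive_ext_loc with (fun s => sqrt (s + m)).
        -- apply filter_imp with (2 := locally_open_interval _ _ _ ht).
           intros s hs; symmetry; apply hwinv; lra.
        -- eexists; now apply is_derive_sqrt_shift.
      * exact (ex_intro _ _ (hd2 t htm)).
      * rewrite (is_derive_n_unique _ _ _ _ (hd2 t htm)), (hw t htm); simpl sl_q.
        simpl sl_r; rewrite (hrt t htm), <- (sqrt_pow4 (t + m)) by lra.
        assert (h := sqrt_lt_R0 _ htm).
        (* The term [w (1/w)''] contributes [-1/4] over [sqrt (t + m) ^ 4], which leaves [k]. *)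
        replace q0 with (k + 1 / 4) by lra; field; lra.
    + simpl sl_a; simpl sl_delta0; rewrite <- hxa, hw, Rplus_0_l by lra.
      rewrite pow_inv, pow2_sqrt by lra; field; lra.
    + simpl sl_b; simpl sl_gamma0; fold (x PI); rewrite hw by lra.
      rewrite pow_inv, pow2_sqrt by lra; field; lra.
    + intros lam v u huv; split.
      (* From [v] to [u]: the multiplier is the weight, [ti' = exp (y + x0)] is its inverse square,
         and [om'' / om = 1/4] turns [k] into [q0]. *)
      * apply sl_solution_liouville with (om := fun y => exp (- ((y + x0) / 2)))
          (om1 := fun y => - / 2 * exp (- ((y + x0) / 2)))
          (om2 := fun y => / 4 * exp (- ((y + x0) / 2))) (phi := ti); try lra.
        -- apply Rlt_le, Rplus_lt_compat_l, ln_increasing; lra.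
        -- intros y _; apply Rgt_not_eq, exp_pos.
        -- intros y _; auto_derive; [trivial | unfold Rdiv; ring].
        -- intros y _; auto_derive; [trivial | unfold Rdiv; field].
        -- intros y _; unfold ti.
           rewrite <- Rpower_pow by apply exp_pos.
           unfold Rpower; rewrite ln_exp, <- exp_Ropp.
           auto_derive; [trivial | ].
           rewrite Rmult_1_l; f_equal; simpl; field.
        -- intros y [h1 h2]; apply htilt in h1; apply htilt in h2; lra.
        -- intros y _.
           assert (h := htipos y).
           (* Writing [y] as [x (ti y)] turns the weight into [/ sqrt (ti y + m)], leaving an
              algebraic identity in [ti y + m]. *)
           rewrite <- (liouville_weight_canonical_form q0 x0
             (- x0 + ln m) (- x0 + ln (PI + m)) m (PI + m) y).
           fold C; rewrite <- (htix y), hw, (htix y), pow_inv, sqrt_pow4 by lra.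
           assert (h' := sqrt_lt_R0 _ h).
           replace q0 with (k + 1 / 4) by lra; field; lra.
        -- intros y _.
           assert (h := htipos y).
           rewrite <- (liouville_weight_canonical_form q0 x0
             (- x0 + ln m) (- x0 + ln (PI + m)) m (PI + m) y).
           fold C; rewrite <- (htix y), hw, hrt, pow_inv, sqrt_pow4 by lra.
           field; lra.
        -- intros y hy; rewrite <- (htix y) at 1.
           rewrite huv by auto; rewrite htix; unfold C.
           now rewrite liouville_weight_canonical_form.
      (* From [u] back to [v]: the multiplier is [1 / w] and the change of variable is [x], with
         [x' = / (t + m) = / om ^ 2]. *)
      * apply sl_solution_liouville with (om := fun t => sqrt (t + m))
          (om1 := fun t => / (2 * sqrt (t + m)))
          (om2 := fun t => - / (4 * sqrt (t + m) ^ 3)) (phi := x); try lra.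
        -- intros t ht; apply Rgt_not_eq, sqrt_lt_R0; lra.
        -- intros t ht; apply is_derive_sqrt_shift; lra.
        -- intros t ht; apply is_derive_inv_sqrt_shift; lra.
        -- intros t ht; rewrite pow2_sqrt by lra; apply hdx; lra.
        -- reflexivity.
        -- intros t ht; rewrite <- hxa; fold (x PI); split; apply hxlt; lra.
        -- intros t ht; assert (h : 0 < t + m) by lra.
           rewrite <- (sqrt_pow4 (t + m)) by lra.
           assert (h' := sqrt_lt_R0 _ h).
           replace q0 with (k + 1 / 4) by lra; field; lra.
        -- intros t ht; rewrite hrt, sqrt_pow4 by lra; field; lra.
        -- intros t ht; assert (h : 0 < t + m) by lra.
           rewrite huv, hw by trivial.
           assert (h' := sqrt_lt_R0 _ h); field; lra.
  - intros t ht; split; [reflexivity | simpl; rewrite hrt by lra; ring].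
  (* The boundary conditions reduce to [m * u a = 0] and [(PI + m) * u b = 0], with positive
     factors. *)
  - intros lam u [u1 (_ & _ & _ & ha & hb)]; unfold C in ha, hb; simpl in *.
    split.
    + apply Rmult_eq_reg_l with m; lra.
    + apply Rmult_eq_reg_l with (PI + m); lra.
Qed.
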